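(* For every $n\ge1$, $$\sum_{\pi\in\mathfrak S_n(2413,3142)}t^{\mathrm{des}(\pi)}=\sum_{\pi\in\mathfrak S_n(2413,4213)}t^{\mathrm{des}(\pi)},$$ and $$\sum_{\pi\in\mathfrak S_n(2413,4213)}t^{\mathrm{DES}(\pi)}=\sum_{\pi\in\mathfrak S_n(2314,3214)}t^{\mathrm{DES}(\pi)}=\sum_{\pi\in\mathfrak S_n(3412,4312)}t^{\mathrm{DES}(\pi)}.$$
   Context: For patterns $P_1,P_2$, $\mathfrak S_n(P_1,P_2)$ is the set of permutations of $[n]$ containing no subsequence order isomorphic to $P_1$ or $P_2$. $\mathrm{DES}(\pi)=\{i\in[n-1]:\pi_i>\pi_{i+1}\}$, $\mathrm{des}(\pi)=|\mathrm{DES}(\pi)|$, and for a set $A$ of positive integers $t^{A}=\prod_{i\in A}t_i$ (a monomial in commuting variables $t_1,t_2,\dots$), while $t^{\mathrm{des}(\pi)}$ is a power of a single variable $t$. *)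

(* Defs.v *)
From HB Require Import structures.
From mathcomp Require Import all_boot all_order all_algebra all_fingroup.
Set Implicit Arguments. Unset Strict Implicit. Unset Printing Implicit Defensive.
Import GRing.Theory.

(* Permutations of [n] are elements of 'S_n (acting on 'I_n = {0,..,n-1};
   the shift by one is harmless for order isomorphism).
   A pattern is given as the sequence of its values, e.g. [:: 2; 4; 1; 3]. *)

Definition contains (n : nat) (sigma : 'S_n) (P : seq nat) : bool :=
  [exists f : {ffun 'I_(size P) -> 'I_n},
     [forall a : 'I_(size P), forall b : 'I_(size P),
        ((a < b)%N ==> (f a < f b)%N) &&
        ((sigma (f a) < sigma (f b))%N == (nth 0 P a < nth 0 P b)%N)]].

Definition Sav (n : nat) (P1 P2 : seq nat) : {set 'S_n} :=
  [set sigma : 'S_n | ~~ contains sigma P1 & ~~ contains sigma P2].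

(* Descent set. Position i : 'I_n (0-based) stands for the 1-based position
   i+1; DES = { i in [n-1] : pi_i > pi_(i+1) }. *)
Definition DES (n : nat) (sigma : 'S_n) : {set 'I_n} :=
  [set i : 'I_n | (i.+1 < n)%N &&
     [exists j : 'I_n, (val j == i.+1) && (sigma j < sigma i)%N]].

Definition des (n : nat) (sigma : 'S_n) : nat := #|DES sigma|.

(* Squarefree monomials t^A = prod_(i in A) t_i in commuting variables t_i,
   i ranging over positions of [n]; a Z-linear combination of such monomials
   is represented by its coefficient function {set 'I_n} -> int
   (the monomial t^A is the indicator of A). *)
Definition sqfreePoly (n : nat) := {ffun {set 'I_n} -> int}.

Definition tmon (n : nat) (A : {set 'I_n}) : sqfreePoly n :=
  [ffun B => ((B == A)%:R)%R].

Definition desPoly (n : nat) (P1 P2 : seq nat) : {poly int} :=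
  (\sum_(sigma in Sav n P1 P2) 'X^(des sigma))%R.

Definition DESPoly (n : nat) (P1 P2 : seq nat) : sqfreePoly n :=
  (\sum_(sigma in Sav n P1 P2) tmon (DES sigma))%R.

(* Main.v *)
Require Import Defs.
From mathcomp Require Import all_boot all_order all_algebra all_fingroup.
From mathcomp Require Import zify ring.

(** Call a letter value an active site of an avoider if appending it as a new last
    letter gives an avoider again.  For the three classes avoiding {ab}cd (a and b in
    either order, c the smallest, d between, above or below a and b), after appending
    the i-th active site the sites up to the new last letter are the i first old ones,
    while above it there is one site if the appended one was the largest and there are
    two otherwise.  Hence the three classes have the same generating tree, with the
    same descents.

    For separable permutations let t mark descents and z the length.  Splitting off the
    first component of a direct or skew sum shows that their series S satisfies
    S = z (1 + D + E), E = (1 + D) S, D = t (1 + E) S, where z E and z D count the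
    direct and the skew sums.  In the generating tree above, the descendants of a node
    with p sites below and 1, respectively 2, sites above its last letter have series
    (1 + S) (1 + D)^p, respectively (1 + S) (1 + E) (1 + D)^p, as these satisfy the same
    recursion; at the root p = 1 this is (1 + S) (1 + D) = S / z. *)

Set Implicit Arguments. Unset Strict Implicit. Unset Printing Implicit Defensive.
Import GRing.Theory.

(** * Permutations as words, with their descents *)

Definition ex4 m (B : nat -> nat -> nat -> nat -> bool) :=
  [exists a : 'I_m, exists b : 'I_m, exists c : 'I_m, exists d : 'I_m, B a b c d].

Lemma ex4P m (B : nat -> nat -> nat -> nat -> bool) :
  reflect (exists a b c d, [/\ a < m, b < m, c < m & d < m] /\ B a b c d) (ex4 m B).
Proof.
apply: (iffP existsP) => [[a /existsP[b /existsP[c /existsP[d h]]]]|].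
  by exists a, b, c, d; split => //; split.
move=> [a [b [c [d [[la lb lc ld] h]]]]]; exists (Ordinal la); apply/existsP.
exists (Ordinal lb); apply/existsP; exists (Ordinal lc); apply/existsP.
by exists (Ordinal ld).
Qed.

Definition word n (s : 'S_n) : seq nat := [seq val (s i) | i <- enum 'I_n].

Lemma size_word n (s : 'S_n) : size (word s) = n.
Proof. by rewrite size_map size_enum_ord. Qed.

Lemma nth_word n (s : 'S_n) (i : 'I_n) : nth 0 (word s) i = s i.
Proof. by rewrite (nth_map i) ?size_enum_ord // nth_ord_enum. Qed.

Lemma word_inj n : injective (@word n).
Proof.
by move=> s t e; apply/permP => i; apply/val_inj; rewrite /= -!nth_word e.
Qed.

Lemma perm_iotaP m n w :
  reflect [/\ uniq w, size w = n & forall x, x \in w -> m <= x < m + n]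
          (perm_eq w (iota m n)).
Proof.
apply: (iffP idP) => [h|[u s b]].
  split; first by rewrite (perm_uniq h) iota_uniq.
    by rewrite (perm_size h) size_iota.
  by move=> x; rewrite (perm_mem h) mem_iota.
apply: uniq_perm => //; first exact: iota_uniq.
have [] // := uniq_min_size u (s2 := iota m n).
  by move=> x /b; rewrite mem_iota.
by rewrite size_iota s.
Qed.

(** [word] is injective and both lists have [n]! entries, so one inclusion suffices. *)
Lemma word_perms n :
  perm_eq [seq word s | s <- enum 'S_n] (permutations (iota 0 n)).
Proof.
have U : uniq [seq word s | s <- enum 'S_n].
  by rewrite map_inj_uniq ?enum_uniq //; apply: word_inj.
apply: uniq_perm => //; first exact: permutations_uniq.
have [] // := uniq_min_size U (s2 := permutations (iota 0 n)).
  move=> w /mapP[s _ ->]; rewrite mem_permutations; apply/perm_iotaP; split.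
  - rewrite map_inj_uniq ?enum_uniq // => i j /val_inj; exact: perm_inj.
  - exact: size_word.
  - by move=> x /mapP[i _ ->] /=; rewrite ltn_ord.
by rewrite size_permutations ?iota_uniq // size_iota size_map -cardE card_Sn.
Qed.

Lemma sum_word (V : nmodType) n (a : pred (seq nat)) (F : seq nat -> V) :
  (\sum_(s : 'S_n | a (word s)) F (word s) =
   \sum_(w <- permutations (iota 0 n) | a w) F w)%R.
Proof. by rewrite -(perm_big _ (word_perms n)) /= big_map big_enum_cond. Qed.

(* The first letter is compared with 0, so [ds w] has length [size w] and starts with
   [false]: entry i tells whether there is a descent between positions i-1 and i. *)
Definition ds (w : seq nat) : bitseq := pairmap (fun x y => y < x) 0 w.

Definition dset n (D : bitseq) : {set 'I_n} := [set i : 'I_n | nth false D i.+1].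

Lemma DES_word n (s : 'S_n) : DES s = dset n (ds (word s)).
Proof.
apply/setP => i; rewrite !inE; case: ltnP => h /=; last first.
  by rewrite nth_default // size_pairmap size_word.
rewrite (nth_pairmap 0) ?size_word //=.
apply/existsP/idP => [[j /andP[/eqP e]]|].
  by rewrite -e -!nth_word.
by exists (Ordinal h); rewrite eqxx /= -!nth_word.
Qed.

Lemma ds_false w : nth false (ds w) 0 = false.
Proof. by case: w. Qed.

(** The shift in [dset] skips entry 0 and reads one default value past the end; both are [false]. *)
Lemma card_dset n D : size D = n -> nth false D 0 = false ->
  #|dset n D| = count id D.
Proof.
case: D => [<- _|b D <- /= ->].
  by apply: eq_card0 => -[].
rewrite add0n -sum1_card.
rewrite (eq_bigl (fun i : 'I_(size D).+1 => nth false D i)); last first.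
  by move=> i; rewrite inE.
rewrite -(big_mkord (nth false D) (fun=> 1)) big_mkcond big_nat_recr //=.
rewrite nth_default // addn0 -sum1_count [RHS]big_mkcond [RHS](big_nth false).
by apply: eq_bigr.
Qed.

(** * Pattern containment in words *)

Definition same_order (s P : seq nat) :=
  all (fun a => all (fun b => (nth 0 s a < nth 0 s b) == (nth 0 P a < nth 0 P b))
    (iota 0 (size P))) (iota 0 (size P)).

Definition at4 (w : seq nat) (Q : nat -> nat -> nat -> nat -> bool) a b c d :=
  Q (nth 0 w a) (nth 0 w b) (nth 0 w c) (nth 0 w d).

Lemma contains_word n (s : 'S_n) P : size P = 4 ->
  contains s P = ex4 n (fun a b c d => [&& a < b, b < c, c < d &
    at4 (word s) (fun x y z t => same_order [:: x; y; z; t] P) a b c d]).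
Proof.
move=> sP; apply/existsP/ex4P.
  move=> [f /forallP h].
  have g k : k < 4 -> k < size P by rewrite sP.
  pose o k (lk : k < 4) := Ordinal (g k lk).
  pose F k (lk : k < 4) := f (o k lk).
  have H a b la lb : ((a < b) ==> (F a la < F b lb)) &&
    ((s (F a la) < s (F b lb)) == (nth 0 P a < nth 0 P b)).
    by have /forallP/(_ (o b lb)) := h (o a la).
  exists (F 0 isT), (F 1 isT), (F 2 isT), (F 3 isT).
  split; first by split; apply: ltn_ord.
  apply/and4P; split; [by case/andP: (H 0 1 isT isT) | by case/andP: (H 1 2 isT isT) |
    by case/andP: (H 2 3 isT isT) |].
  rewrite /at4 /same_order sP; apply/allP => a la; apply/allP => b lb.
  rewrite !mem_iota /= add0n in la lb.
  have /andP[_ /eqP <-] := H a b la lb; apply/eqP; rewrite !nth_word.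
  congr (_ < _).
    by case: a la => [|[|[|[|]]]] //= la; congr (val (s _)); rewrite (bool_irrelevance la isT).
  by case: b lb => [|[|[|[|]]]] //= lb; congr (val (s _)); rewrite (bool_irrelevance lb isT).
move=> [a [b [c [d [[la lb lc ld] /and4P[ab bc cd H]]]]]].
pose f := [ffun i : 'I_(size P) => nth (Ordinal la)
   [:: Ordinal la; Ordinal lb; Ordinal lc; Ordinal ld] i].
exists f; apply/forallP => i; apply/forallP => j; rewrite !ffunE.
(* The default on the right is the image of the default ordinal on the left, so this holds for every
   [k]. *)
have ws k : val (s (nth (Ordinal la)
   [:: Ordinal la; Ordinal lb; Ordinal lc; Ordinal ld] k)) =
   nth (nth 0 (word s) a) [:: nth 0 (word s) a; nth 0 (word s) b; nth 0 (word s) c;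
                              nth 0 (word s) d] k.
  rewrite -[a]/(val (Ordinal la)) -[b]/(val (Ordinal lb)) -[c]/(val (Ordinal lc))
    -[d]/(val (Ordinal ld)) !nth_word.
  by case: k => [|[|[|[|k]]]] //=; rewrite !nth_nil.
apply/andP; split.
  apply/implyP; case: i => i /=; case: j => j /=; rewrite !sP.
  by case: i => [|[|[|[|]]]] //=; case: j => [|[|[|[|]]]] //= *;
    rewrite ?(ltn_trans _ cd) // ?(ltn_trans ab) // ltnS.
move: H; rewrite /at4 /same_order => /allP/(_ i); rewrite mem_iota ltn_ord => /(_ isT).
move=> /allP/(_ j); rewrite mem_iota ltn_ord => /(_ isT).
rewrite /= !ws => /eqP <-; apply/eqP.
have li : i < 4 := leq_trans (ltn_ord i) (eq_leq sP).
have lj : j < 4 := leq_trans (ltn_ord j) (eq_leq sP).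
by congr (_ < _); apply: set_nth_default.
Qed.

Inductive slot := Between | Above | Below.

Definition in_slot r x y z t :=
  match r with
  | Between => x < t < y
  | Above => y < t
  | Below => z < t < x
  end.

(** [x] and [y] are the first two letters sorted by value, not by position, so that one predicate
    serves both patterns of a class. *)
Definition pat r x y z t := [&& z < x, x < y & in_slot r x y z t].

Definition pattern r : seq nat :=
  match r with
  | Between => [:: 2; 4; 1; 3]
  | Above => [:: 2; 3; 1; 4]
  | Below => [:: 3; 4; 1; 2]
  end.

Definition pattern' r : seq nat :=
  match r with
  | Between => [:: 4; 2; 1; 3]
  | Above => [:: 3; 2; 1; 4]
  | Below => [:: 4; 3; 1; 2]
  end.

(* Positions a and b are not ordered: [bad r] covers [pattern r] and [pattern' r]. *)
Definition bad r w := ex4 (size w) (fun a b c d =>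
  [&& a < c, b < c, c < d & at4 w (pat r) a b c d]).

(** The disjuncts are 2413 and 3142, with [x], [y], [z], [t] in order of position. *)
Definition sepbad w := ex4 (size w) (fun a b c d =>
  [&& a < b, b < c, c < d &
    at4 w (fun x y z t => (z < x < t) && (t < y) || (y < t < x) && (x < z)) a b c d]).

Lemma same_order_pattern r x y z t :
  same_order [:: x; y; z; t] (pattern r) = pat r x y z t.
Proof. by case: r; rewrite /same_order /pat /=; lia. Qed.

Lemma same_order_pattern' r x y z t :
  same_order [:: x; y; z; t] (pattern' r) = pat r y x z t.
Proof. by case: r; rewrite /same_order /pat /=; lia. Qed.

Lemma contains_bad r n (s : 'S_n) :
  contains s (pattern r) || contains s (pattern' r) = bad r (word s).
Proof.
rewrite !contains_word; try by case: r.
rewrite /bad size_word; apply/orP/ex4P.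
  case=> /ex4P[a [b [c [d [[la lb lc ld]]]]]];
    rewrite /at4 ?same_order_pattern ?same_order_pattern' => /and4P[ab bc cd H].
    by exists a, b, c, d; split => //; rewrite (ltn_trans ab bc) bc cd.
  by exists b, a, c, d; split => //; rewrite (ltn_trans ab bc) bc cd.
move=> [a [b [c [d [[la lb lc ld]]]]]] /and4P[ac bc cd H].
case: (ltngtP a b) => [ab|ba|E].
- left; apply/ex4P; exists a, b, c, d; split => //.
  by rewrite ab bc cd /at4 same_order_pattern.
- right; apply/ex4P; exists b, a, c, d; split => //.
  by rewrite ba ac cd /at4 same_order_pattern'.
- by move: H; rewrite /at4 E /pat ltnn andbF.
Qed.

Lemma contains_sepbad n (s : 'S_n) :
  contains s [:: 2; 4; 1; 3] || contains s [:: 3; 1; 4; 2] = sepbad (word s).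
Proof.
rewrite !contains_word // /sepbad size_word; apply/orP/ex4P.
  case=> /ex4P[a [b [c [d [[la lb lc ld]]]]]]
      /and4P[ab bc cd]; rewrite /at4 /same_order /= => H;
    exists a, b, c, d; split => //; rewrite ab bc cd; lia.
move=> [a [b [c [d [[la lb lc ld]]]]]] /and4P[ab bc cd].
rewrite /at4 => /orP[] H; [left | right]; apply/ex4P; exists a, b, c, d;
  split => //; rewrite ab bc cd /same_order /=; lia.
Qed.

Definition perms n (a : pred (seq nat)) := [seq w <- permutations (iota 0 n) | a w].

Lemma sum_Sav (V : nmodType) n P1 P2 (a : pred (seq nat)) (F : {set 'I_n} -> V) :
  (forall s : 'S_n, contains s P1 || contains s P2 = ~~ a (word s)) ->
  (\sum_(s in Sav n P1 P2) F (DES s) = \sum_(w <- perms n a) F (dset n (ds w)))%R.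
Proof.
move=> H; rewrite big_filter -sum_word; apply: eq_big => [s|s _].
  by rewrite inE -negb_or H negbK.
by rewrite DES_word.
Qed.

(** * Appending a last letter, and the patterns it completes *)

Definition ins v k := rcons (map (bump k) v) k.

Lemma size_ins v k : size (ins v k) = (size v).+1.
Proof. by rewrite size_rcons size_map. Qed.

Lemma bump_ltn k x y : (bump k x < bump k y) = (x < y).
Proof. by rewrite /bump; lia. Qed.

Lemma nth_ins v k i : nth 0 (ins v k) i =
  if i < size v then bump k (nth 0 v i) else if i == size v then k else 0.
Proof.
rewrite nth_rcons size_map; case: ltnP => // h; exact: (nth_map 0).
Qed.

Lemma ins_inj v k v' k' : ins v k = ins v' k' -> v = v' /\ k = k'.
Proof.
by case/rcons_inj => e1 e2; move: e1; rewrite -e2 => /(inj_map (can_inj (@bumpK k))).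
Qed.

Definition badsite r v d := [exists c : 'I_(size v), exists a : 'I_c, exists b : 'I_c,
  pat r (bump d (nth 0 v a)) (bump d (nth 0 v b)) (bump d (nth 0 v c)) d].

Lemma badsiteP r v d :
  reflect (exists a b c, [/\ a < c, b < c & c < size v] /\
    pat r (bump d (nth 0 v a)) (bump d (nth 0 v b)) (bump d (nth 0 v c)) d)
  (badsite r v d).
Proof.
apply: (iffP existsP) => [[c /existsP[a /existsP[b h]]]|[a [b [c [[ac bc lc] h]]]]].
  by exists a, b, c.
exists (Ordinal lc); apply/existsP; exists (Ordinal ac); apply/existsP.
by exists (Ordinal bc).
Qed.

Lemma pat_bump r k x y z t :
  pat r (bump k x) (bump k y) (bump k z) (bump k t) = pat r x y z t.
Proof. by case: r; rewrite /pat /in_slot !bump_ltn. Qed.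

(** The last position can only be the fourth one of a pattern, and [bump d] keeps the order of the
    old letters. *)
Lemma bad_ins r v d : bad r (ins v d) = bad r v || badsite r v d.
Proof.
apply/ex4P/orP.
  move=> [a [b [c [e [[la lb lc le]]]]]] /and4P[ac bc ce].
  rewrite size_ins in la lb lc le.
  have hc : c < size v by lia.
  have [ha hb] : a < size v /\ b < size v by split; lia.
  rewrite /at4 !nth_ins hc ha hb; case: ltnP => he.
    rewrite pat_bump => H; left; apply/ex4P; exists a, b, c, e.
    by split; [split | rewrite ac bc ce].
  have -> : e = size v by lia.
  by rewrite eqxx => H; right; apply/badsiteP; exists a, b, c.
case=> [/ex4P[a [b [c [e [[la lb lc le]]]]]] /and4P[ac bc ce H]|].
  exists a, b, c, e; rewrite size_ins; split; first by split; lia.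
  by rewrite ac bc ce /at4 !nth_ins la lb lc le pat_bump.
move=> /badsiteP[a [b [c [[ac bc lc] H]]]]; exists a, b, c, (size v).
rewrite size_ins; split; first by split; lia.
rewrite ac bc lc /at4 !nth_ins lc ltnn eqxx.
by rewrite (ltn_trans ac lc) (ltn_trans bc lc).
Qed.

(* The values that become inactive because the new last letter k plays the role of c. *)
Definition newbad r n k d :=
  match r with
  | Between => k.+1 < d <= n
  | Above => k.+2 < d
  | Below => k < d < n
  end.

(** Relative to the old letters, site [d] after appending [k] is the former site [unbump k d]; both
    [k] and [k.+1] come from [k]. *)
Lemma pat_bump_unbump r k x y z d :
  pat r (bump d (bump k x)) (bump d (bump k y)) (bump d (bump k z)) d =
  pat r (bump (unbump k d) x) (bump (unbump k d) y) (bump (unbump k d) z) (unbump k d).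
Proof.
have below w : (bump d (bump k w) < d) = (bump (unbump k d) w < unbump k d).
  by rewrite /bump /unbump; lia.
have above w : (d < bump d (bump k w)) = (unbump k d < bump (unbump k d) w).
  by rewrite /bump /unbump; lia.
by case: r; rewrite /pat /in_slot !bump_ltn ?below ?above.
Qed.

Lemma nth_perm_iota n v i : perm_eq v (iota 0 n) -> i < n -> nth 0 v i < n.
Proof.
move=> /perm_iotaP[_ sv /(_ (nth 0 v i)) h] li; move: h.
by rewrite mem_nth ?sv //; apply.
Qed.

Lemma nth_perm_iotaV n v x : perm_eq v (iota 0 n) -> x < n ->
  exists2 i, i < n & nth 0 v i = x.
Proof.
move=> p lx; have xv : x \in v by rewrite (perm_mem p) mem_iota.
exists (index x v); last exact: nth_index.
by have := xv; rewrite -index_mem (perm_size p) size_iota.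
Qed.

(** In a pattern completed by [d], the letter [k] can only be the third one. All letters of [v]
    precede it, so whether such a pattern exists depends on values alone. *)
Lemma badsite_ins r n v k d : perm_eq v (iota 0 n) -> k <= n -> d <= n.+1 ->
  badsite r (ins v k) d = badsite r v (unbump k d) || newbad r n k d.
Proof.
move=> pv kn dn; have sv : size v = n by rewrite (perm_size pv) size_iota.
apply/badsiteP/orP.
  move=> [a [b [c [[ac bc]]]]]; rewrite size_ins sv => lc.
  have [ha hb] : a < n /\ b < n by split; lia.
  rewrite !nth_ins sv ha hb; case: ltnP => hc.
    rewrite pat_bump_unbump => H; left; apply/badsiteP; exists a, b, c.
    by rewrite sv.
  have -> : c = n by lia.
  rewrite eqxx => H; right; move: H (nth_perm_iota pv ha) (nth_perm_iota pv hb).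
  by case: r; rewrite /pat /in_slot /newbad /bump; lia.
case.
  move=> /badsiteP[a [b [c [[ac bc lc] H]]]]; exists a, b, c.
  rewrite size_ins sv in lc *; split; first by split=> //; lia.
  have [ha hb] : a < n /\ b < n by split; lia.
  by rewrite !nth_ins sv ha hb lc pat_bump_unbump.
move=> nb.
have [x [y [lx ly H]]] : exists x y, [/\ x < n, y < n &
    pat r (bump d (bump k x)) (bump d (bump k y)) (bump d k) d].
  (* Extreme choices, in old values: the least letter above the new one and the greatest letter; the
     two least above it; the two greatest. *)
  case: r nb => /= nb.
  - exists k, n.-1; split; rewrite /pat /in_slot /bump; lia.
  - exists k, k.+1; split; rewrite /pat /in_slot /bump; lia.
  - exists n.-2, n.-1; split; rewrite /pat /in_slot /bump; lia.
have [[a la ea] [b lb eb]] := (nth_perm_iotaV pv lx, nth_perm_iotaV pv ly).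
exists a, b, n; rewrite size_ins sv; split; first by split.
by rewrite !nth_ins sv la lb ltnn eqxx ea eb.
Qed.

(** Unless the slot is [Above], some letter of the pattern exceeds its last one. *)
Lemma badsite_top n v r : perm_eq v (iota 0 n) -> r <> Above -> ~~ badsite r v n.
Proof.
move=> pv hr; apply/badsiteP => -[a [b [c [[ac bc lc]]]]].
rewrite (perm_size pv) size_iota in lc.
have := nth_perm_iota pv (ltn_trans ac lc); have := nth_perm_iota pv (ltn_trans bc lc).
by case: r hr => // _; rewrite /pat /in_slot /bump; lia.
Qed.

(** Two letters would have to exceed the last one, but at most one does. *)
Lemma badsite_below_top n v : perm_eq v (iota 0 n) -> ~~ badsite Below v n.-1.
Proof.
move=> pv; apply/badsiteP => -[a [b [c [[ac bc lc]]]]].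
rewrite (perm_size pv) size_iota in lc.
have := nth_perm_iota pv (ltn_trans ac lc); have := nth_perm_iota pv (ltn_trans bc lc).
by rewrite /pat /in_slot /bump; lia.
Qed.

Lemma badsite_above_mono v d d' : d <= d' -> badsite Above v d -> badsite Above v d'.
Proof.
move=> dd /badsiteP[a [b [c [H1 H2]]]]; apply/badsiteP; exists a, b, c; split => //.
by move: H2; rewrite /pat /in_slot /bump; lia.
Qed.

(** * Active sites of an avoider and of its children *)

Definition act r v := [seq k <- iota 0 (size v).+1 | ~~ bad r (ins v k)].

Lemma mem_act r v k : ~~ bad r v -> (k \in act r v) = (k <= size v) && ~~ badsite r v k.
Proof.
by move=> nb; rewrite mem_filter mem_iota bad_ins (negbTE nb) /= ltnS andbC.
Qed.

Lemma sorted_act r v : sorted ltn (act r v).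
Proof. by apply: sorted_filter; [apply: ltn_trans | apply: iota_ltn_sorted]. Qed.

Section Child.

Variables (r : slot) (n : nat) (v : seq nat) (k : nat).
Hypotheses (pv : perm_eq v (iota 0 n)) (nb : ~~ bad r v) (ka : k \in act r v).

Let sv : size v = n. Proof. by rewrite (perm_size pv) size_iota. Qed.
Let kn : k <= n. Proof. by move: ka; rewrite mem_act // sv => /andP[]. Qed.
Let ks : badsite r v k = false.
Proof. by move: ka; rewrite mem_act // => /andP[_ /negbTE]. Qed.
Let nbk : ~~ bad r (ins v k). Proof. by rewrite bad_ins negb_or nb ks. Qed.

Lemma mem_act_ins d : (d \in act r (ins v k)) =
  [&& d <= n.+1, ~~ badsite r v (unbump k d) & ~~ newbad r n k d].
Proof.
rewrite mem_act // size_ins sv; case: leqP => //= dn.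
by rewrite (badsite_ins r pv kn dn) negb_or.
Qed.

(** [unbump k] fixes the sites up to [k], and the new letter spoils only sites above itself. *)
Lemma act_ins_le : [seq d <- act r (ins v k) | d <= k] = [seq d <- act r v | d <= k].
Proof.
apply: (irr_sorted_eq ltn_trans ltnn); try by
  apply: (sorted_filter ltn_trans); apply: sorted_act.
move=> d; rewrite mem_filter [RHS]mem_filter mem_act_ins mem_act // sv; case: leqP => //= dk.
have -> : unbump k d = d by rewrite /unbump; lia.
have -> : newbad r n k d = false by case: (r) => /=; lia.
by rewrite andbT; lia.
Qed.

(** The sites left above [k] are [k.+1] and the top one for [Between], [k.+1] and [k.+2] for
    [Above], the two top ones for [Below]; only one is left if [k] was the largest active site. *)
Lemma act_ins_gt :
  size [seq d <- act r (ins v k) | k < d] = (has (ltn k) (act r v)).+1.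
Proof.
(* For [Between] and [Below] the top site [n] is always active. *)
have hasE : r <> Above -> has (ltn k) (act r v) = (k < n).
  move=> rA; apply/hasP/idP => [[d]|h].
    by rewrite mem_act // sv => /andP[dn _] /= kd; lia.
  by exists n => //; rewrite mem_act // sv leqnn badsite_top.
(* For [Above] the active sites form an initial interval. *)
have hasA : r = Above -> has (ltn k) (act r v) = (k.+1 \in act r v).
  move=> rA; apply/hasP/idP => [[d]|h]; last by exists k.+1 => //=.
  rewrite !mem_act // => /andP[dn hd] /= kd; rewrite (leq_trans kd dn) /=.
  by apply: contra hd; rewrite [r in badsite r]rA; apply: badsite_above_mono.
have key L : uniq L -> (forall d, (d \in L) = (k < d) && (d \in act r (ins v k))) ->
    size [seq d <- act r (ins v k) | k < d] = size L.
  move=> uL mL; apply/perm_size/uniq_perm => //.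
    by apply/filter_uniq/(sorted_uniq ltn_trans ltnn)/sorted_act.
  by move=> d; rewrite mem_filter mL.
have ub d : k < d -> unbump k d = d.-1 by rewrite /unbump; lia.
have [kn'|kn'] := eqVneq k n.
  have -> : has (ltn k) (act r v) = false.
    apply/hasP => -[d]; rewrite mem_act // sv => /andP[]; rewrite /= kn'; lia.
  apply: (key [:: n.+1]) => // d; rewrite mem_act_ins inE.
  case: (ltnP k d) => [kd|]; last by lia.
  rewrite ub // andTb; have [->|dn] := eqVneq d n.+1; last by lia.
  rewrite leqnn -kn' ks /= kn'; case: (r) => /=; lia.
have {}kn' : k < n by lia.
case E: (r) => //; rewrite -E.
- rewrite hasE ?kn'; last by rewrite E.
  apply: (key [:: k.+1; n.+1]); first by rewrite /= inE; lia.
  move=> d; rewrite mem_act_ins !inE.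
  case: (ltnP k d) => [kd|]; last by lia.
  have h1 : badsite r v n = false by apply/negbTE/badsite_top => //; rewrite E.
  rewrite ub // [r in newbad r]E /=.
  have [->|d1] := eqVneq d k.+1; first by rewrite /= ks; lia.
  have [->|d2] := eqVneq d n.+1; first by rewrite /= h1; lia.
  by case: (badsite _ _ _) => /=; lia.
- have kE : badsite r v k.+1 = ~~ has (ltn k) (act r v).
    by rewrite hasA // mem_act // sv kn' negbK.
  case H: (has (ltn k) (act r v)) kE => /= kE.
    apply: (key [:: k.+1; k.+2]); first by rewrite /= inE; lia.
    move=> d; rewrite mem_act_ins !inE; case: (ltnP k d) => [kd|]; last by lia.
    rewrite ub // [r in newbad r]E /=.
    have [->|d1] := eqVneq d k.+1; first by rewrite /= ks; lia.
    have [->|d2] := eqVneq d k.+2; first by rewrite /= kE; lia.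
    by lia.
  apply: (key [:: k.+1]) => // d; rewrite mem_act_ins !inE.
  case: (ltnP k d) => [kd|]; last by lia.
  rewrite ub // [r in newbad r]E /=.
  have [->|d1] := eqVneq d k.+1; first by rewrite /= ks; lia.
  have -> : badsite r v d.-1.
    by rewrite E; apply: (@badsite_above_mono _ k.+1); [lia | rewrite -E].
  by rewrite andbF.
- rewrite hasE ?kn'; last by rewrite E.
  apply: (key [:: n; n.+1]); first by rewrite /= inE; lia.
  move=> d; rewrite mem_act_ins !inE.
  case: (ltnP k d) => [kd|]; last by lia.
  have h1 : badsite r v n = false by apply/negbTE/badsite_top => //; rewrite E.
  have h2 : badsite r v n.-1 = false by apply/negbTE; rewrite E badsite_below_top.
  rewrite ub // [r in newbad r]E /=.
  have [->|d1] := eqVneq d n; first by rewrite /= h2; lia.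
  have [->|d2] := eqVneq d n.+1; first by rewrite /= h1; lia.
  by case: (badsite _ _ _) => /=; lia.
Qed.

End Child.

(** * The common generating tree of the three classes *)

Definition good r w := ~~ bad r w.

(* The number of active sites below and above the last letter; the former produce the
   descents. *)
Definition lo r w := count (leq^~ (last 0 w)) (act r w).
Definition hi r w := count (ltn (last 0 w)) (act r w).

Lemma nth_le_count s l i : sorted ltn s -> i < size s ->
  (nth 0 s i <= l) = (i < count (leq^~ l) s).
Proof.
elim: s i => // x s IH i xs; have {IH}IH := IH _ (path_sorted xs).
have /allP lx := order_path_min ltn_trans xs.
have c0 : l < x -> count (leq^~ l) s = 0.
  move=> h; apply/eqP; rewrite -leqn0 leqNgt -has_count; apply/hasP => -[y /lx] /=; lia.
case: i => [_|i] /=; first by case: (leqP x l) => //= /c0 ->.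
rewrite ltnS => /IH ->; case: (leqP x l) => //= /c0 ->; lia.
Qed.

Lemma count_nth s i : sorted ltn s -> i < size s ->
  count (leq^~ (nth 0 s i)) s = i.+1.
Proof.
move=> ss li; apply/eqP; rewrite eqn_leq -nth_le_count // leqnn andbT leqNgt.
apply/negP => h; have h' := leq_trans h (count_size _ _).
move: h; rewrite -nth_le_count // leqNgt.
by rewrite (sorted_ltn_nth ltn_trans 0 ss) ?inE.
Qed.

(** Reindexes the children by the rank of the chosen site, which determines the descent, the new
    [lo] and the new [hi]. *)
Lemma sum_sorted (V : nmodType) (G : bool -> nat -> bool -> V) l s : sorted ltn s ->
  (\sum_(k <- s) G (k <= l)%N (count (leq^~ k) s) (has (ltn k) s) =
   \sum_(i < size s) G (i < count (leq^~ l) s)%N i.+1 (i.+1 < size s)%N)%R.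
Proof.
move=> ss; rewrite (big_nth 0) big_mkord; apply: eq_bigr => i _.
rewrite nth_le_count // count_nth //; congr (G _ _ _).
have -> : has (ltn (nth 0 s i)) s = ~~ all (leq^~ (nth 0 s i)) s.
  by rewrite -has_predC; apply: eq_has => x /=; rewrite ltnNge.
by rewrite all_count count_nth //; have := ltn_ord i; lia.
Qed.

Lemma ins_perms n : perm_eq
  [seq ins v k | v <- permutations (iota 0 n), k <- iota 0 n.+1]
  (permutations (iota 0 n.+1)).
Proof.
have U : uniq [seq ins v k | v <- permutations (iota 0 n), k <- iota 0 n.+1].
  apply: allpairs_uniq; rewrite ?permutations_uniq ?iota_uniq //.
  by move=> [v k] [v' k'] _ _ /ins_inj [-> ->].
apply: uniq_perm => //; first exact: permutations_uniq.
have [] // := uniq_min_size U (s2 := permutations (iota 0 n.+1)).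
  move=> w /allpairsP[[v k] /= [vP kP ->]]; rewrite mem_permutations.
  move: vP (kP : k \in iota 0 n.+1).
  rewrite mem_permutations mem_iota => /perm_iotaP[uv sv bv] kn.
  apply/(perm_iotaP 0 n.+1); rewrite size_ins sv; split => //.
    rewrite rcons_uniq (map_inj_uniq (can_inj (@bumpK k))) uv andbT.
    by apply/mapP => -[x _]; rewrite /bump; lia.
  move=> x; rewrite mem_rcons inE => /orP[/eqP ->|/mapP[y /bv hy ->]]; first by lia.
  by rewrite /bump; lia.
by rewrite size_allpairs !size_permutations ?iota_uniq // !size_iota factS mulnC.
Qed.

Lemma sum_perms_ins (V : nmodType) r n (F : seq nat -> V) :
  (\sum_(w <- perms n.+1 (good r)) F w =
   \sum_(v <- perms n (good r)) \sum_(k <- act r v) F (ins v k))%R.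
Proof.
rewrite big_filter -(perm_big _ (ins_perms n)) big_mkcond big_allpairs_dep.
rewrite big_filter [RHS]big_mkcond; apply: eq_big_seq => v.
rewrite mem_permutations => /perm_size; rewrite size_iota => sv.
case: ifP => gv; first by rewrite -big_mkcond big_filter sv.
apply: big1 => k _; rewrite /good bad_ins.
by move: gv; rewrite /good => /negbT; rewrite negbK => ->.
Qed.

Lemma ds_rcons v k : ds (rcons v k) = rcons (ds v) (k < last 0 v).
Proof. by rewrite /ds -cats1 pairmap_cat cats1. Qed.

Lemma pairmap_gtn_map g x v : {mono g : x y / x < y} ->
  pairmap (fun x y => y < x) (g x) (map g v) = pairmap (fun x y => y < x) x v.
Proof. by move=> gm; elim: v x => //= y v IH x; rewrite IH gm. Qed.

Lemma ds_map g v : {mono g : x y / x < y} -> ds (map g v) = ds v.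
Proof. by case: v => //= x v gm; rewrite /ds /= pairmap_gtn_map. Qed.

(** Equality gives a descent too, as an old last letter equal to [k] is raised above it. *)
Lemma ds_ins v k : 0 < size v -> ds (ins v k) = rcons (ds v) (k <= last 0 v).
Proof.
case: v => // x v _; rewrite /ins ds_rcons ds_map; last exact: bump_ltn.
by congr rcons; rewrite /= last_map /bump; lia.
Qed.

(** Sums [f] over the nodes of depth [n], labelled by descent word, [lo] and [hi]. Each step
    replaces [f] by its sum over the children; the root is the one-letter word. *)
Fixpoint tree (V : nmodType) n (f : bitseq -> nat -> nat -> V) : V :=
  if n is n'.+1 then
    tree n' (fun D p q => \sum_(i < p + q)
      f (rcons D (i < p)%N) i.+1 (i.+1 < p + q)%N.+1)%R
  else f [:: false] 1 1.

Lemma small_good r w : size w < 3 -> good r w.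
Proof. by move=> sw; apply/negP => /ex4P[a [b [c [d [[? ? ? ?] /and4P[]]]]]]; lia. Qed.

(** Induction on [n] by removing the last letter; the labels of the children follow one rule, in
    which [r] does not occur. *)
Lemma sum_good_tree (V : nmodType) r n (f : bitseq -> nat -> nat -> V) :
  (\sum_(w <- perms n.+1 (good r)) f (ds w) (lo r w) (hi r w))%R = tree n f.
Proof.
elim: n f => [|n IH] f.
  have -> : perms 1 (good r) = [:: [:: 0]].
    by rewrite /perms /= small_good.
  have aE : act r [:: 0] = iota 0 2.
    by apply/all_filterP/allP => k _; apply: small_good.
  by rewrite big_seq1 /lo /hi aE.
rewrite sum_perms_ins /= -IH; apply: eq_big_seq => v.
rewrite mem_filter mem_permutations => /andP[gv pv].
have sv : size v = n.+1 by rewrite (perm_size pv) size_iota.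
have -> : lo r v + hi r v = size (act r v).
  rewrite -(count_predC (leq^~ (last 0 v))); congr addn.
  by apply: eq_count => x /=; rewrite ltnNge.
rewrite -(sum_sorted (fun b p q => f (rcons (ds v) b) p q.+1) _ (sorted_act r v)).
apply: eq_big_seq => k ka; rewrite ds_ins ?sv //.
rewrite -(act_ins_gt pv gv ka) /lo /hi last_rcons.
by rewrite -!size_filter (act_ins_le pv gv ka).
Qed.

Lemma sum_pattern (V : nmodType) r n (F : {set 'I_n.+1} -> V) :
  (\sum_(s in Sav n.+1 (pattern r) (pattern' r)) F (DES s) =
   tree n (fun D _ _ => F (dset n.+1 D)))%R.
Proof.
rewrite (sum_Sav _ (a := good r)) -?(sum_good_tree r) // => s.
by rewrite contains_bad negbK.
Qed.

(** * Direct and skew decompositions *)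

(** [true] stands for direct sums, [false] for skew sums. *)
Definition lt_dir (e : bool) x y := if e then x < y else y < x.

Definition splits_at e w k :=
  [&& 0 < k, k < size w & allrel (lt_dir e) (take k w) (drop k w)].

Definition decomposable e w := has (splits_at e w) (iota 0 (size w)).

Lemma splits_atP e w k :
  reflect [/\ 0 < k, k < size w &
    forall i j, i < k -> k <= j < size w -> lt_dir e (nth 0 w i) (nth 0 w j)]
  (splits_at e w k).
Proof.
apply: (iffP and3P) => -[k0 kw H]; split => //.
  move=> i j ik /andP[kj jw]; apply: (allrelP H).
    by rewrite -(nth_take 0 ik) mem_nth // size_takel // ltnW.
  by rewrite -(subnKC kj) -nth_drop mem_nth // size_drop ltn_sub2r.
apply/allrelP => x y /(nthP 0)[i]; rewrite size_takel ?(ltnW kw) // => ik <-.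
move=> /(nthP 0)[j]; rewrite size_drop => jw <-.
rewrite nth_take // nth_drop; apply: H => //.
by rewrite leq_addr -ltn_subRL.
Qed.

Lemma decomposableP e w : reflect (exists k, splits_at e w k) (decomposable e w).
Proof.
apply: (iffP hasP) => [[k _ ?]|[k h]]; exists k => //.
by rewrite mem_iota; case/and3P: h.
Qed.

Lemma splits_at_take e w k j : splits_at e w k -> j < k ->
  splits_at e (take k w) j = splits_at e w j.
Proof.
move=> /splits_atP[k0 kw H] jk; have sk : size (take k w) = k by rewrite size_takel // ltnW.
apply/splits_atP/splits_atP; rewrite sk => -[j0 _ G]; split => //; first by lia.
  move=> i l ij /andP[jl lw]; case: (ltnP l k) => lk.
    by have := G i l ij; rewrite !nth_take //; [apply; rewrite jl | lia].
  by apply: H; lia.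
by move=> i l ij /andP[jl lk]; rewrite !nth_take //; [apply: G => //; lia | lia].
Qed.

(** The first [k] letters are the first component of the sum. *)
Definition minsplit e w k := splits_at e w k && ~~ decomposable e (take k w).

Lemma minsplit_exists e w : decomposable e w -> exists k, minsplit e w k.
Proof.
move=> /decomposableP h; case: (ex_minnP h) => k sk min; exists k; rewrite /minsplit sk /=.
apply/decomposableP => -[j sj]; have jk : j < k.
  case/and3P: sj => _ + _; rewrite size_takel //; case/and3P: sk => _ /ltnW //.
by move: sj; rewrite splits_at_take // => /min; rewrite leqNgt jk.
Qed.

Lemma minsplit_uniq e w j k : minsplit e w j -> minsplit e w k -> j = k.
Proof.
wlog jk : j k / j < k.
  by move=> H hj hk; case: (ltngtP j k) => // ?; [exact: H | apply/esym/H].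
move=> /andP[sj _] /andP[sk /decomposableP[]]; exists j; by rewrite splits_at_take.
Qed.

(** 2413 and 3142 are neither direct nor skew sums, so no occurrence meets both parts. *)
Lemma sepbad_cat e u v : allrel (lt_dir e) u v ->
  sepbad (u ++ v) = sepbad u || sepbad v.
Proof.
move=> /allrelP uv.
have H i j : i < size u -> size u <= j < size u + size v ->
    lt_dir e (nth 0 (u ++ v) i) (nth 0 (u ++ v) j).
  move=> iu ju; have jv : j - size u < size v by lia.
  rewrite !nth_cat iu ltnNge; case/andP: ju => -> /= _.
  by apply: uv; apply: mem_nth.
apply/ex4P/orP.
  move=> [a [b [c [d [[la lb lc ld]]]]]]; rewrite size_cat in la lb lc ld.
  move=> /and4P[ab bc cd].
  have [du|du] := ltnP d (size u).
    rewrite /at4 !nth_cat du (ltn_trans cd du) (ltn_trans bc (ltn_trans cd du)).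
    rewrite (ltn_trans ab (ltn_trans bc (ltn_trans cd du))) => P.
    left; apply/ex4P; exists a, b, c, d; split; last by rewrite ab bc cd.
    by split; lia.
  have [au|au] := ltnP a (size u); last first.
    have [ub uc] : size u <= b /\ size u <= c by lia.
    rewrite /at4 !nth_cat.
    rewrite (leq_gtF au) (leq_gtF ub) (leq_gtF uc) (leq_gtF du) => P.
    right; apply/ex4P; exists (a - size u), (b - size u), (c - size u), (d - size u).
    by split; [split; lia | rewrite /at4 P andbT; lia].
  have Had := H a d au; have Hbd := H b d; have Hcd := H c d.
  have Hab := H a b au; have Hac := H a c au; have Hbc := H b c.
  rewrite /at4; move: Had Hbd Hcd Hab Hac Hbc {H}.
  move: (nth 0 _ a) (nth 0 _ b) (nth 0 _ c) (nth 0 _ d) => xa xb xc xd.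
  rewrite /lt_dir; case: (e); case: (ltnP b (size u)); case: (ltnP c (size u)); lia.
case=> /ex4P[a [b [c [d [[la lb lc ld] /and4P[ab bc cd P]]]]]].
  exists a, b, c, d; rewrite size_cat; split; first by split; lia.
  by rewrite ab bc cd /at4 !nth_cat la lb lc ld.
exists (size u + a), (size u + b), (size u + c), (size u + d).
rewrite size_cat !ltn_add2l; split => //.
by rewrite ab bc cd /at4 !nth_cat !(leq_gtF (leq_addr _ _)) !addKn.
Qed.

Lemma sepbad_rcons v x : sepbad v -> sepbad (rcons v x).
Proof.
move=> /ex4P[a [b [c [d [[la lb lc ld] h]]]]]; apply/ex4P; exists a, b, c, d.
by rewrite size_rcons; split; [split; lia | rewrite /at4 !nth_rcons la lb lc ld].
Qed.

Lemma lt_dirN e x y : x != y -> ~~ lt_dir e x y = lt_dir (~~ e) x y.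
Proof. by rewrite /lt_dir; case: e => /=; lia. Qed.

(* If the word without its last letter x splits minimally after k letters, then
   either the first k letters all lie on one side of x, or, by minimality, some letter
   among them exceeding x precedes one below x (in the order [lt_dir e]), and these two
   letters, one of the second part and x make a forbidden pattern. *)
Lemma decomposable_total w : uniq w -> 1 < size w -> ~~ sepbad w ->
  decomposable true w || decomposable false w.
Proof.
move=> uw sw gw; suff [e he] : exists e, decomposable e w by case: e he => ->; rewrite ?orbT.
elim/(@last_ind nat): w uw sw gw => // v x IH.
rewrite rcons_uniq size_rcons => /andP[xv uv] sv gw.
have gv : ~~ sepbad v by apply: contra gw; apply: sepbad_rcons.
have neq i : i < size v -> nth 0 v i != x.
  by move=> iv; apply: contraNneq xv => <-; apply: mem_nth.
have nthv i : i < size v -> nth 0 (rcons v x) i = nth 0 v i.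
  by move=> iv; rewrite nth_rcons iv.
have nthx : nth 0 (rcons v x) (size v) = x by rewrite nth_rcons ltnn eqxx.
have last_split e : (forall i, i < size v -> lt_dir e (nth 0 v i) x) ->
    decomposable e (rcons v x).
  move=> H; apply/decomposableP; exists (size v); apply/splits_atP; rewrite size_rcons.
  split=> // i j iv jv; have -> : j = size v by lia.
  by rewrite nthx nthv // H.
case: (ltnP 1 (size v)) => sv'; last first.
  exists (lt_dir true (nth 0 v 0) x); apply: last_split => i iv.
  have -> : i = 0 by lia.
  by rewrite /lt_dir; case: ltngtP (neq 0 sv) => //= ->; rewrite eqxx.
have [e /minsplit_exists[k /andP[sk mk]]] := IH uv sv' gv.
have [k0 kv H] := splits_atP _ _ _ sk.
have [hall|] := boolP (all (fun i => lt_dir e (nth 0 v i) x) (iota 0 k)).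
  exists e; apply/decomposableP; exists k; apply/splits_atP; rewrite size_rcons; split => //.
    exact: ltnW.
  move=> i j ik /andP[kj jv]; rewrite nthv; last exact: ltn_trans ik kv.
  case: (ltnP j (size v)) => jv'; first by rewrite nthv // H // kj.
  have -> : j = size v by lia.
  by rewrite nthx (allP hall) // mem_iota.
have [hall _|] := boolP (all (fun i => lt_dir (~~ e) (nth 0 v i) x) (iota 0 (size v))).
  by exists (~~ e); apply: last_split => i iv; rewrite (allP hall) // mem_iota.
move=> /allPn[b]; rewrite mem_iota add0n => /andP[_ bv] hb.
move=> /allPn[a]; rewrite mem_iota add0n => /andP[_ ak] ha.
have av := ltn_trans ak kv.
rewrite lt_dirN ?neq // in ha; rewrite lt_dirN ?neq // negbK in hb.
(* Letters from position [k] on lie beyond the one at [a], hence beyond [x]. *)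
have bk : b < k.
  rewrite ltnNge; apply/negP => kb; have := H a b ak; rewrite kb bv => /(_ isT).
  by move: ha hb; rewrite /lt_dir; case: (e) => /=; lia.
have exj : exists j, lt_dir (~~ e) (nth 0 v j) x by exists a.
(* [j] is the first position of a letter beyond [x]. If all letters from there up to [k] were beyond
   [x], the prefix would split at [j]. *)
case: (ex_minnP exj) => j hj minj; have ja := minj _ ha.
have below i : i < j -> lt_dir e (nth 0 v i) x.
  move=> ij; have iv : i < size v by lia.
  rewrite -[e]negbK -lt_dirN ?neq //.
  by apply/negP => /minj; rewrite leqNgt ij.
have [hall|nall] := boolP (all (fun i => lt_dir (~~ e) (nth 0 v i) x) (iota j (k - j))).
  have j0 : 0 < j.
    rewrite lt0n; apply/eqP => jE; move: hall => /allP/(_ b).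
    rewrite mem_iota jE subn0 add0n bk => /(_ isT).
    by move: hb; rewrite /lt_dir; case: (e) => /=; lia.
  case/decomposableP: mk; exists j; rewrite splits_at_take //; last exact: leq_ltn_trans ja ak.
  apply/splits_atP; split=> //; first by lia.
  move=> i l ij /andP[jl lv]; case: (ltnP l k) => lk; last first.
    apply: H; last by rewrite lk.
    exact: leq_trans ij (leq_trans ja (ltnW ak)).
  have := below i ij; have := allP hall l; rewrite mem_iota jl subnKC; last by lia.
  move=> /(_ lk); rewrite /lt_dir; clear; case: e => /= h1 h2.
    exact: ltn_trans h2 h1.
  exact: ltn_trans h1 h2.
have {nall} /allPn[i] := nall; rewrite mem_iota subnKC; last by lia.
move=> /andP[ji ik] hi; rewrite lt_dirN ?negbK in hi; last by apply: neq; lia.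
have {}ji : j < i.
  rewrite ltn_neqAle ji andbT; apply: contraTneq hi => <-.
  by move: hj; rewrite /lt_dir; case: (e) => /=; lia.
case/negP: gw; apply/ex4P; exists j, i, k, (size v); rewrite size_rcons.
have iv := ltn_trans ik kv; have jv := ltn_trans ji iv.
split; first by split; rewrite ?ltnSn // leqW.
rewrite ji ik kv /at4 nthx !nthv //.
have := H j k (ltn_trans ji ik); rewrite leqnn kv => /(_ isT).
by move: hi hj; rewrite /lt_dir; case: (e) => /=; lia.
Qed.

(** The first letter would be both below and above the last one. *)
Lemma decomposable_excl w : decomposable true w -> ~~ decomposable false w.
Proof.
move=> /decomposableP[k /splits_atP[k0 kw H]]; apply/decomposableP => -[j].
move=> /splits_atP[j0 jw G].
have := H 0 (size w).-1 k0; have := G 0 (size w).-1 j0.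
by rewrite /lt_dir; lia.
Qed.

Lemma decomposable_falseE m n w : perm_eq w (iota m n) -> 1 < n -> ~~ sepbad w ->
  decomposable false w = ~~ decomposable true w.
Proof.
move=> /perm_iotaP[uw sw _] n1 gw.
have := decomposable_total uw; rewrite sw => /(_ n1 gw); have := @decomposable_excl w.
by case: (decomposable true w) => /= [/(_ isT)/negbTE ->|_ ->].
Qed.

(** Sorting the parts separately sorts the whole, so they are consecutive blocks of [iota m n]. *)
Lemma perm_cat_iota m n u v : allrel ltn u v -> perm_eq (u ++ v) (iota m n) ->
  perm_eq u (iota m (size u)) /\ perm_eq v (iota (m + size u) (size v)).
Proof.
move=> /allrelP uv p; have sn : n = size u + size v.
  by rewrite -size_cat (perm_size p) size_iota.
have E : sort leq u ++ sort leq v = iota m n.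
  apply: (sorted_eq leq_trans anti_leq); last first.
  - by apply: perm_trans p; apply: perm_cat; rewrite perm_sort.
  - exact: iota_sorted.
  rewrite (sorted_pairwise leq_trans) pairwise_cat -!(sorted_pairwise leq_trans).
  rewrite !(sort_sorted leq_total) !andbT; apply/allrelP => x y.
  by rewrite !mem_sort => xu /(uv _ _ xu)/ltnW.
move: E; rewrite sn iotaD => /eqP; rewrite eqseq_cat ?size_sort ?size_iota //.
by move=> /andP[/eqP <- /eqP <-]; split; rewrite perm_sym perm_sort.
Qed.

(* The values taken by the two parts of a word on [iota m n] split after k letters. *)
Definition lft (e : bool) m n k := if e then m else m + (n - k).
Definition rgt (e : bool) m k := if e then m + k else m.

Lemma allrel_cat_iota e m n u v : perm_eq (u ++ v) (iota m n) ->
  allrel (lt_dir e) u v =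
  perm_eq u (iota (lft e m n (size u)) (size u)) &&
  perm_eq v (iota (rgt e m (size u)) (size v)).
Proof.
move=> p; have sn : n = size u + size v by rewrite -size_cat (perm_size p) size_iota.
rewrite sn /lft /rgt addKn; apply/idP/andP.
  case: e => [/perm_cat_iota/(_ p)[]|] // uv.
  have vu : allrel ltn v u by rewrite allrelC; apply: uv.
  by have [] // := perm_cat_iota vu (etrans (perm_catC _ _ _) p).
case=> /perm_iotaP[_ _ hu] /perm_iotaP[_ _ hv]; apply/allrelP => x y /hu hx /hv hy.
by move: hx hy; rewrite /lt_dir; case: (e); lia.
Qed.

(** * Counting separable words by descents *)

(** The offset [m] is there because the components of a sum are words on shifted intervals. *)
Definition Sep m n := [seq w <- permutations (iota m n) | ~~ sepbad w].

Lemma mem_Sep m n w : (w \in Sep m n) = ~~ sepbad w && perm_eq w (iota m n).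
Proof. by rewrite mem_filter mem_permutations. Qed.

Lemma size_Sep m n w : w \in Sep m n -> size w = n.
Proof. by rewrite mem_Sep => /andP[_ /perm_size]; rewrite size_iota. Qed.

Lemma uniq_Sep m n : uniq (Sep m n).
Proof. by rewrite filter_uniq ?permutations_uniq. Qed.

(** Cutting after the first component and gluing are inverse to each other; avoidance passes to the
    parts by [sepbad_cat]. *)
Lemma perm_minsplit e m n k : 0 < k < n ->
  perm_eq [seq w <- Sep m n | minsplit e w k]
    [seq u ++ v | u <- [seq u <- Sep (lft e m n k) k | ~~ decomposable e u],
                  v <- Sep (rgt e m k) (n - k)].
Proof.
move=> kn; apply: uniq_perm.
- exact: filter_uniq (uniq_Sep _ _).
- apply: allpairs_uniq; [exact: filter_uniq (uniq_Sep _ _) | exact: uniq_Sep |].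
  move=> [u v] [u' v'] /allpairsP[[a b] /= [ha _ [-> ->]]].
  move=> /allpairsP[[a' b'] /= [ha' _ [-> ->]]] /eqP.
  move: ha ha'; rewrite !mem_filter => /andP[_ /andP[_ ha]] /andP[_ /andP[_ ha']].
  move: ha ha'; rewrite !mem_permutations => /perm_size sa /perm_size sa'.
  by rewrite eqseq_cat ?sa ?sa' // => /andP[/eqP -> /eqP ->].
move=> w; rewrite mem_filter mem_Sep; apply/idP/allpairsP.
  move=> /andP[/andP[sk dk] /andP[gw pw]]; exists (take k w, drop k w) => /=.
  have sw : size w = n by rewrite (perm_size pw) size_iota.
  have st : size (take k w) = k by rewrite size_takel // sw; lia.
  case/and3P: sk => _ _ al; rewrite cat_take_drop; split => //.
    move: gw; rewrite -{1}(cat_take_drop k w) (sepbad_cat al) negb_or => /andP[gt gd].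
    rewrite mem_filter mem_Sep dk gt /=.
    have := al; rewrite (@allrel_cat_iota _ m n) ?cat_take_drop // st.
    by case/andP.
  move: gw; rewrite -{1}(cat_take_drop k w) (sepbad_cat al) negb_or => /andP[gt gd].
  rewrite mem_Sep gd /=.
  have := al; rewrite (@allrel_cat_iota _ m n) ?cat_take_drop // st size_drop sw.
  by case/andP.
move=> [[u v] /= []]; rewrite mem_filter !mem_Sep.
move=> /and3P[du gu pu] /andP[gv pv] ->.
have su : size u = k by rewrite (perm_size pu) size_iota.
have sv : size v = n - k by rewrite (perm_size pv) size_iota.
have p : perm_eq (u ++ v) (iota m n).
  case: (e) pu pv; rewrite /lft /rgt => pu pv.
    by have -> : n = k + (n - k) by [lia]; rewrite iotaD perm_cat.
  have -> : n = (n - k) + k by lia.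
  by rewrite iotaD perm_catC perm_cat.
have al : allrel (lt_dir e) u v by rewrite (allrel_cat_iota _ p) su sv pu pv.
rewrite /minsplit /splits_at size_cat su sv take_size_cat // drop_size_cat // al du.
by rewrite (sepbad_cat al) negb_or gu gv p; lia.
Qed.

Definition desw w := count id (ds w).

(** The border is a descent exactly in the skew case. *)
Lemma desw_cat e u v : 0 < size u -> 0 < size v -> allrel (lt_dir e) u v ->
  desw (u ++ v) = desw u + ~~ e + desw v.
Proof.
case: v => // y v; case: u => // x u _ _ /allrelP H.
rewrite /desw /ds pairmap_cat count_cat -addnA; congr addn; rewrite /= add0n.
congr (_ + _); have := H _ _ (mem_last x u) (mem_head y v).
by rewrite /lt_dir; case: (e) => /=; lia.
Qed.

Local Open Scope ring_scope.

Definition sep_gf m n : {poly int} := \sum_(w <- Sep m n) 'X^(desw w).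

Definition dec_gf e m n : {poly int} := \sum_(w <- Sep m n | decomposable e w) 'X^(desw w).

Lemma sep_gf_dec m n : (1 < n)%N -> sep_gf m n = dec_gf true m n + dec_gf false m n.
Proof.
move=> n1; rewrite /sep_gf (bigID (decomposable true)) /=; congr (_ + _).
rewrite /dec_gf big_seq_cond [RHS]big_seq_cond; apply: eq_bigl => w.
case: (boolP (w \in Sep m n)) => //; rewrite mem_Sep => /andP[gw pw] /=.
by rewrite (decomposable_falseE pw n1 gw).
Qed.

(** [k] is the length of the first component, unique by [minsplit_uniq]; the difference counts the
    indecomposable words. *)
Lemma dec_gf_rec e m n : dec_gf e m n =
  \sum_(k <- iota 1 n.-1) (sep_gf (lft e m n k) k - dec_gf e (lft e m n k) k) *
    'X^(~~ e) * sep_gf (rgt e m k) (n - k).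
Proof.
transitivity (\sum_(w <- Sep m n) \sum_(k <- iota 1 n.-1 | minsplit e w k)
    ('X^(desw w) : {poly int})).
  rewrite /dec_gf big_mkcond; apply: eq_big_seq => w /size_Sep sw.
  case: ifP => dw; last first.
    rewrite big1 // => k /andP[sk _]; case/decomposableP: (dw); by exists k.
  have [k hk] := minsplit_exists dw.
  rewrite big_mkcond (bigD1_seq k) ?iota_uniq //=; last first.
    have [k0 kn] : (0 < k)%N /\ (k < n)%N by rewrite -sw; case/andP: hk => /and3P[].
    by rewrite mem_iota; lia.
  rewrite hk big1 ?addr0 // => j jk; case: ifP => // hj.
  by rewrite (minsplit_uniq hj hk) eqxx in jk.
under eq_bigr do rewrite big_mkcond.
rewrite exchange_big; apply: eq_big_seq => k; rewrite mem_iota => kn.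
have {}kn : (0 < k < n)%N by lia.
rewrite -big_mkcond -big_filter (perm_big _ (perm_minsplit e m kn)) big_allpairs_dep.
have -> : sep_gf (lft e m n k) k - dec_gf e (lft e m n k) k =
    \sum_(u <- [seq u <- Sep (lft e m n k) k | ~~ decomposable e u]) 'X^(desw u).
  by rewrite /sep_gf (bigID (decomposable e)) /= addrC addrK big_filter.
rewrite -mulrA big_distrl; apply: eq_big_seq => u uS.
rewrite [RHS]mulrA big_distrr; apply: eq_big_seq => v vS.
move: uS; rewrite mem_filter => /andP[_ uS].
have [su sv] := (size_Sep uS, size_Sep vS).
move: uS vS; rewrite !mem_Sep => /andP[_ pu] /andP[_ pv] /=.
rewrite -!exprD (@desw_cat e) ?su ?sv //; try by lia.
have /perm_iotaP[_ _ hu] := pu; have /perm_iotaP[_ _ hv] := pv.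
apply/allrelP => x y /hu hx /hv hy.
by move: hx hy; rewrite /lft /rgt /lt_dir; case: (e); lia.
Qed.

Lemma small_sepgood w : (size w < 4)%N -> ~~ sepbad w.
Proof. by move=> sw; apply/negP => /ex4P[a [b [c [d [[? ? ? ?] /and4P[]]]]]]; lia. Qed.

Lemma Sep_small n m : (n <= 1)%N -> Sep m n = [:: iota m n].
Proof. by case: n => [|[|]] // _; rewrite /Sep /= small_sepgood. Qed.

Lemma dec_gf_small e m n : (n <= 1)%N -> dec_gf e m n = 0.
Proof. by case: n => [|[|]] // _; rewrite dec_gf_rec big_nil. Qed.

Lemma sep_gf_small m n : (n <= 1)%N -> sep_gf m n = 1.
Proof. by case: n => [|[|]] // _; rewrite /sep_gf Sep_small // big_seq1. Qed.

(** The recursion has the same form for every offset, so strong induction on the length removes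
    it. *)
Lemma sep_gf_shift e m n : dec_gf e m n = dec_gf e 0 n /\ sep_gf m n = sep_gf 0 n.
Proof.
have [N] := ubnP n; elim: N n m e => // N IH n m e nN.
have H e' : dec_gf e' m n = dec_gf e' 0 n.
  rewrite dec_gf_rec [RHS]dec_gf_rec; apply: eq_big_seq => k; rewrite mem_iota => kn.
  have [k1 k2] : (k < N /\ n - k < N)%N by lia.
  have I j m' : (j < N)%N -> dec_gf e' m' j = dec_gf e' 0 j.
    by move=> jN; have [] := IH j m' e' jN.
  have J j m' : (j < N)%N -> sep_gf m' j = sep_gf 0 j by move=> jN; have [] := IH j m' e' jN.
  by rewrite !(I _ (lft _ _ _ _)) // !(J _ (lft _ _ _ _)) // !(J _ (rgt _ _ _)).
split=> //; case: (ltnP 1 n) => n1; last by rewrite !sep_gf_small.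
by rewrite !sep_gf_dec // !H.
Qed.

(** * Descent polynomials along the generating tree *)

Lemma eq_tree (V : nmodType) n (f g : bitseq -> nat -> nat -> V) :
  (forall D p q, f D p q = g D p q) -> tree n f = tree n g.
Proof.
elim: n f g => /= [f g -> //|n IH f g fg]; apply: IH => D p q.
by apply: eq_bigr => i _; rewrite fg.
Qed.

Local Open Scope ring_scope.

(** Counts the descendants [m] levels below a node with labels [p], [q] by the descents added on the
    way. *)
Fixpoint node_gf m p q : {poly int} :=
  if m is m'.+1 then
    \sum_(i < p + q) 'X^(i < p)%N * node_gf m' i.+1 (i.+1 < p + q)%N.+1
  else 1.

Lemma tree_node_gf n m :
  tree n (fun D p q => 'X^(count id D) * node_gf m p q) = node_gf (n + m) 1 1.
Proof.
elim: n m => [|n IH] m; first by rewrite /= mul1r.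
rewrite addSnnS -IH /=; apply: eq_tree => D p q /=; rewrite big_distrr.
apply: eq_bigr => i _ /=.
by rewrite -cats1 count_cat /= addn0 exprD mulrA.
Qed.

(** * Series identities modulo a power of the length variable *)

Section Series.

Variable N : nat.

(** The outer variable marks the length minus one, the inner one descents. The series are cut at
    degree [N], so their identities hold up to a multiple of ['X^N]. *)
Let G e : {poly {poly int}} := \poly_(i < N) dec_gf e 0 i.+1.
Let D := G false.
Let E := G true.
Let S := 'X * (1 + D + E).
Let t : {poly {poly int}} := 'X%:P.

(** A word indecomposable in direction [e] is a single letter or decomposable in the other
    direction. *)
Lemma sep_gf_sub_dec e k :
  sep_gf 0 k.+1 - dec_gf e 0 k.+1 = (k == 0)%:R + dec_gf (~~ e) 0 k.+1.
Proof.
case: k => [|k]; first by rewrite sep_gf_small // !dec_gf_small // subr0 addr0.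
by rewrite sep_gf_dec // add0r; case: e => /=; rewrite ?addrK // addrC addKr.
Qed.

Lemma coefG e i : (i < N)%N -> (1 + G (~~ e))`_i = sep_gf 0 i.+1 - dec_gf e 0 i.+1.
Proof. by move=> iN; rewrite coefD coef1 coef_poly iN sep_gf_sub_dec. Qed.

Lemma coefS i : (i < N)%N -> S`_i.+1 = sep_gf 0 i.+1.
Proof.
move=> iN; rewrite coefXM /= -addrA -[D]/(G (~~ true)) addrA coefD coefG //.
by rewrite coef_poly iN subrK.
Qed.

(** The multiple of ['X^N] is kept explicit so that [ring] can treat congruences. *)
Lemma eq_modXn (a b : {poly {poly int}}) :
  (forall i, (i < N)%N -> a`_i = b`_i) -> exists r, a = b + r * 'X^N.
Proof.
move=> ab; exists (drop_poly N (a - b)); apply/eqP; rewrite addrC -subr_eq; apply/eqP.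
rewrite -{1}[a - b](poly_take_drop N) -[RHS]add0r; congr (_ + _).
apply/polyP => i; rewrite coef_take_poly coef0; case: ifP => // /ab.
by rewrite coefB => ->; rewrite subrr.
Qed.

Lemma G_eq e : exists r, G e = ('X^(~~ e))%:P * (1 + G (~~ e)) * S + r * 'X^N.
Proof.
apply: eq_modXn => n nN; rewrite coef_poly nN dec_gf_rec -mulrA coefCM coefM.
(* The last term of the convolution vanishes since [S] has no constant term; lengths are then
   renumbered from 0. *)
rewrite big_ord_recr /= subnn coefXM mulr0 addr0 big_distrr /=.
rewrite -[1%N]/(1 + 0)%N iotaDl big_map -{1}[n]subn0 big_mkord.
apply: eq_bigr => i _; have [h1 h2] := sep_gf_shift e (lft e 0 n.+1 (1 + i)) (1 + i).
rewrite h1 h2; have [_ ->] := sep_gf_shift e (rgt e 0 (1 + i)) (n.+1 - (1 + i)).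
have iN : (i < N)%N := ltn_trans (ltn_ord i) nN.
rewrite coefG // subSS -[(n - i)%N]prednK ?subn_gt0 //.
rewrite coefS; first by rewrite mulrCA mulrA.
by apply: leq_ltn_trans nN; lia.
Qed.

Lemma E_eq : exists r, E = (1 + D) * S + r * 'X^N.
Proof. by have [r h] := G_eq true; exists r; rewrite {1}/E h /= expr0 mul1r. Qed.

Lemma D_eq : exists r, D = t * (1 + E) * S + r * 'X^N.
Proof. by have [r h] := G_eq false; exists r; rewrite {1}/D h /= expr1. Qed.

Lemma S_eq : exists r, 'X * (1 + S) * (1 + D) = S + r * 'X^N.
Proof.
have [e hE] := E_eq; exists (- 'X * e).
have -> : 'X * (1 + S) * (1 + D) = 'X * (1 + D) + 'X * ((1 + D) * S) by ring.
have -> : (1 + D) * S = E - e * 'X^N by rewrite {1}hE addrK.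
by rewrite /S; ring.
Qed.

(** The children at the sites below the last letter: by [S_eq] and [D_eq] the common factor becomes
    [D], and [D] times the sum of the powers of [1 + D] telescopes. *)
Lemma geom_eq p : exists r,
  'X * \sum_(i < p) t * ((1 + S) * (1 + E) * (1 + D) ^+ i.+1) =
  (1 + D) ^+ p - 1 + r * 'X^N.
Proof.
have [r hS] := S_eq; have [e hD] := D_eq.
pose Q := \sum_(i < p) (1 + D) ^+ i.
exists ((t * (1 + E) * r - e) * Q).
have -> : (1 + D) ^+ p - 1 = D * Q by rewrite subrX1 addrC addKr.
have -> : 'X * \sum_(i < p) t * ((1 + S) * (1 + E) * (1 + D) ^+ i.+1) =
    t * (1 + E) * ('X * (1 + S) * (1 + D)) * Q.
  rewrite /Q !big_distrr /=; apply: eq_bigr => i _; rewrite exprS; ring.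
rewrite hS; have -> : t * (1 + E) * (S + r * 'X^N) =
   t * (1 + E) * S + t * (1 + E) * r * 'X^N by ring.
have -> : t * (1 + E) * S = D - e * 'X^N by rewrite {1}hD addrK.
ring.
Qed.

(** The recursion at labels [p], 1: descents lead to labels [i.+1], 2 and the top site to [p.+1],
    1. *)
Lemma node1_eq p : exists r,
  1 + 'X * (\sum_(i < p) t * ((1 + S) * (1 + E) * (1 + D) ^+ i.+1) +
            (1 + S) * (1 + D) ^+ p.+1) =
  (1 + S) * (1 + D) ^+ p + r * 'X^N.
Proof.
have [r hS] := S_eq; have [e hg] := geom_eq p.
exists (e + r * (1 + D) ^+ p).
rewrite mulrDr hg exprS.
have -> : 'X * ((1 + S) * ((1 + D) * (1 + D) ^+ p)) =
  'X * (1 + S) * (1 + D) * (1 + D) ^+ p by ring.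
by rewrite hS; ring.
Qed.

(** The recursion at labels [p], 2: the lower site above the last letter leads to [p.+1], 2 and the
    top one to [p.+2], 1. By [E_eq], [(1 + D) * S] turns into [E]. *)
Lemma node2_eq p : exists r,
  1 + 'X * (\sum_(i < p) t * ((1 + S) * (1 + E) * (1 + D) ^+ i.+1) +
            (1 + S) * (1 + E) * (1 + D) ^+ p.+1 + (1 + S) * (1 + D) ^+ p.+2) =
  (1 + S) * (1 + E) * (1 + D) ^+ p + r * 'X^N.
Proof.
have [r hS] := S_eq; have [e hg] := geom_eq p; have [f hE] := E_eq.
exists (e - f * (1 + D) ^+ p + r * (1 + E) * (1 + D) ^+ p + r * (1 + D) * (1 + D) ^+ p).
rewrite 2!(mulrDr 'X) hg !exprS.
have -> : 'X * ((1 + S) * (1 + E) * ((1 + D) * (1 + D) ^+ p)) =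
  'X * (1 + S) * (1 + D) * (1 + E) * (1 + D) ^+ p by ring.
have -> : 'X * ((1 + S) * ((1 + D) * ((1 + D) * (1 + D) ^+ p))) =
  'X * (1 + S) * (1 + D) * (1 + D) * (1 + D) ^+ p by ring.
rewrite hS.
have -> : (S + r * 'X^N) * (1 + D) = E - f * 'X^N + r * 'X^N * (1 + D).
  by rewrite {1}hE; ring.
ring.
Qed.

Lemma node_gf_coef m p : (m < N)%N ->
  node_gf m p 1 = ((1 + S) * (1 + D) ^+ p)`_m /\
  node_gf m p 2 = ((1 + S) * (1 + E) * (1 + D) ^+ p)`_m.
Proof.
(* The multiple of ['X^N] is invisible in degree [k.+1]. *)
have step (F A : {poly {poly int}}) k : (k.+1 < N)%N ->
    (exists r, 1 + 'X * F = A + r * 'X^N) -> F`_k = A`_k.+1.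
  move=> kN [r /(congr1 (fun x : {poly {poly int}} => x`_k.+1))].
  by rewrite !coefD coef1 coefXM coefMXn kN addr0 add0r.
elim: m p => [|m IH] p mN.
  have D0 e : (G e)`_0 = 0 by rewrite coef_poly mN dec_gf_small.
  have S0 : S`_0 = 0 by rewrite coefXM.
  have P0 : ((1 + D) ^+ p)`_0 = 1.
    by rewrite -horner_coef0 horner_exp horner_coef0 coefD coef1 D0 addr0 expr1n.
  by rewrite !coef0M P0 !coefD coef1 S0 D0 !addr0 !mulr1.
have {}IH q := IH q (ltnW mN).
split.
  rewrite -(step _ _ _ mN (node1_eq p)) /= addn1 big_ord_recr /= !ltnn expr0 mul1r.
  rewrite coefD coef_sum; have [-> _] := IH p.+1; congr (_ + _).
  apply: eq_bigr => i _; rewrite ltn_ord ltnS ltn_ord expr1 coefCM.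
  by have [_ ->] := IH i.+1.
rewrite -(step _ _ _ mN (node2_eq p)) /= addn2 !big_ord_recr /=.
rewrite !ltnn ltnS leqnn (leq_gtF (leqnSn p)) !expr0 !mul1r.
rewrite !coefD coef_sum; have [-> _] := IH p.+2; have [_ ->] := IH p.+1.
congr (_ + _ + _); apply: eq_bigr => i _.
have -> : (i.+1 < p.+2)%N by rewrite ltnS ltnW // ltnS ltn_ord.
by rewrite ltn_ord expr1 coefCM; have [_ ->] := IH i.+1.
Qed.

(** The root has labels 1, 1, and [S_eq] identifies its series with [S] divided by ['X]. *)
Lemma node_gf_sep n : (n.+1 < N)%N -> node_gf n 1 1 = sep_gf 0 n.+1.
Proof.
move=> nN; have [-> _] := node_gf_coef 1 (ltnW nN); rewrite expr1 -coefS ?(ltnW nN) //.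
have [r] := S_eq; move=> /(congr1 (fun x : {poly {poly int}} => x`_n.+1)).
by rewrite coefD coefMXn nN addr0 -mulrA coefXM.
Qed.

End Series.

(** * From the classes of permutations to the sums over words *)

Lemma sum_des n P1 P2 (a : pred (seq nat)) :
  (forall s : 'S_n, contains s P1 || contains s P2 = ~~ a (word s)) ->
  desPoly n P1 P2 = \sum_(w <- perms n a) 'X^(desw w).
Proof.
move=> /(sum_Sav (fun A : {set 'I_n} => 'X^#|A| : {poly int})) H.
rewrite /desPoly /des H; apply: eq_big_seq => w.
rewrite mem_filter mem_permutations => /andP[_ /perm_size]; rewrite size_iota => sw.
by rewrite card_dset ?ds_false // size_pairmap.
Qed.

Lemma DESPoly_tree n r : DESPoly n.+1 (pattern r) (pattern' r) =
  tree n (fun D _ _ => tmon (dset n.+1 D)).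
Proof. exact: (sum_pattern r (@tmon n.+1)). Qed.

Local Close Scope ring_scope.

Theorem theorem5p1 (n : nat) (hn : (1 <= n)%N) :
  desPoly n [:: 2; 4; 1; 3] [:: 3; 1; 4; 2]
    = desPoly n [:: 2; 4; 1; 3] [:: 4; 2; 1; 3] /\
  DESPoly n [:: 2; 4; 1; 3] [:: 4; 2; 1; 3]
    = DESPoly n [:: 2; 3; 1; 4] [:: 3; 2; 1; 4] /\
  DESPoly n [:: 2; 3; 1; 4] [:: 3; 2; 1; 4]
    = DESPoly n [:: 3; 4; 1; 2] [:: 4; 3; 1; 2].
Proof.
case: n hn => // n _.
split; last first.
  have [B A L] := And3 (DESPoly_tree n Between) (DESPoly_tree n Above) (DESPoly_tree n Below).
  by rewrite B A L.
rewrite (sum_des (a := fun w => ~~ sepbad w)); last first.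
  by move=> s; rewrite contains_sepbad negbK.
rewrite (sum_des (a := good Between)); last first.
  by move=> s; rewrite -[RHS]negbK negbK /good negbK -contains_bad.
rewrite (sum_good_tree Between n (fun D _ _ => 'X^(count id D))%R).
(* Any [N] above [n.+1] would do. Writing [n] as [n + 0] makes the factor [node_gf 0], which is 1,
   appear at the leaves. *)
rewrite -[LHS](node_gf_sep (N := n.+2)) // -[n in node_gf n]addn0 -tree_node_gf.
by apply: eq_tree => D p q; rewrite mulr1.
Qed.
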